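(* Let $R$ be a commutative ring, $\Lambda$ an $R$-algebra, and $\mathbf{J}$ an injective $R$-module, and put $D_{\mathbf{J}}:=\mathrm{Hom}_R(\_,\mathbf{J})$. Then \[D_{\mathbf{J}}\circ\mathfrak{s}\simeq\mathfrak{q}\circ D_{\mathbf{J}},\] i.e., for each right $\Lambda$-module $A$ there is an isomorphism $D_{\mathbf{J}}(\mathfrak{s}(A))\simeq\mathfrak{q}(D_{\mathbf{J}}(A))$ which is functorial in $A$.
   Context: For a right $\Lambda$-module $A$, $D_{\mathbf{J}}(A)$ is regarded as a left $\Lambda$-module. Let $\iota:\Lambda\to I$ be the injective envelope of $\Lambda$ as a left $\Lambda$-module. For a right $\Lambda$-module $A$, the injective torsion is $\mathfrak{s}(A):=\ker(1\otimes\iota:A\otimes_\Lambda\Lambda\to A\otimes_\Lambda I)$, a submodule of $A\cong A\otimes_\Lambda\Lambda$. For a left $\Lambda$-module $C$, the cotorsion module is $\mathfrak{q}(C):=\mathrm{coker}\big(\mathrm{Hom}_\Lambda(I,C)\to\mathrm{Hom}_\Lambda(\Lambda,C)\big)$ (precomposition with $\iota$), i.e. homomorphisms $\Lambda\to C$ modulo those factoring through injective left modules; it is a quotient module of $C\cong\mathrm{Hom}_\Lambda(\Lambda,C)$. *)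

(* Defs.v *)
From HB Require Import structures.
From mathcomp Require Import all_boot all_order all_algebra.
From mathcomp Require Import ring_quotient generic_quotient.
From mathcomp Require Import boolp.
From mathcomp.multinomials Require Import freeg.

Set Implicit Arguments.
Unset Strict Implicit.
Unset Printing Implicit Defensive.

Import GRing.Theory.
Local Open Scope ring_scope.
Local Open Scope quotient_scope.

(* Algebras over [R] as rings with a central ring morphism from [R].  The library
   structure [algType R] would exclude the zero algebra, its carriers being
   nonzero rings. *)
HB.mixin Record PzRing_isCentralAlgebra (R : pzRingType) L of GRing.PzRing L := {
  alg_map : R -> L;
  alg_map_zmod_morphism : zmod_morphism alg_map;
  alg_map_monoid_morphism : monoid_morphism alg_map;
  alg_map_central : forall r x, alg_map r * x = x * alg_map r
}.

#[short(type="pzAlgType")]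
HB.structure Definition PzAlgebra (R : pzRingType) :=
  {L of PzRing_isCentralAlgebra R L & GRing.PzRing L}.

HB.instance Definition _ (R : pzRingType) (L : pzAlgType R) :=
  GRing.isZmodMorphism.Build R L (@alg_map R L) alg_map_zmod_morphism.
HB.instance Definition _ (R : pzRingType) (L : pzAlgType R) :=
  GRing.isMonoidMorphism.Build R L (@alg_map R L) alg_map_monoid_morphism.

Section AlgTypePzAlgebra.
Variables (R : pzRingType) (L : algType R).

Fact in_alg_central (r : R) (x : L) : r%:A * x = x * r%:A.
Proof. by rewrite -scalerAl mul1r -scalerAr mulr1. Qed.

Definition pzAlgType_of_algType : pzAlgType R :=
  HB.pack_for (pzAlgType R) (GRing.Algebra.sort L)
    (PzRing_isCentralAlgebra.Build R L (raddfB (in_alg L))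
       (rmorphism_monoidP (in_alg L)) in_alg_central).

End AlgTypePzAlgebra.

(* Left modules over [S] are [lmodType S]; right modules over [S] are
   [lmodType S^c], the product [v s] being written [s *: v]. *)

Section Quotient.
Variables (S : pzRingType) (V : lmodType S) (P : submodClosed V).

(* needed because [Quotient.quot] takes a canonical [zmodClosed] predicate, which
   a [submodClosed] variable does not provide *)
Definition lquot_rel : {pred V} := fun v => v \in P.

Fact lquot_rel_zmod_closed : zmod_closed lquot_rel.
Proof.
split=> [|x y Px Py]; first exact: (rpred0 P).
by rewrite unfold_in /lquot_rel rpredD// -scaleN1r rpredZ.
Qed.

HB.instance Definition _ := GRing.isZmodClosed.Build V lquot_rel
  lquot_rel_zmod_closed.

Definition lquot : Type := Quotient.quot lquot_rel.
HB.instance Definition _ := GRing.Zmodule.on lquot.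

Definition lquot_pi (v : V) : lquot := \pi_(Quotient.quot lquot_rel) v.
Definition lquot_repr (x : lquot) : V :=
  repr (x : Quotient.quot lquot_rel).

Lemma lquot_reprK x : lquot_pi (lquot_repr x) = x.
Proof. exact: reprK. Qed.

Lemma lquot_piE u v : (lquot_pi u = lquot_pi v) <-> (u - v \in P).
Proof.
split=> [/eqP|h].
  by rewrite /lquot_pi -Quotient.idealrBE.
by apply/eqP; rewrite /lquot_pi -Quotient.idealrBE.
Qed.

Fact lquot_pi_zmod : zmod_morphism lquot_pi.
Proof. exact: pi_is_zmod_morphism. Qed.

Definition lquot_scale (a : S) (x : lquot) := lquot_pi (a *: lquot_repr x).

Lemma lquot_piZ a v : lquot_pi (a *: v) = lquot_scale a (lquot_pi v).
Proof.
apply/lquot_piE; rewrite -scalerBr rpredZ//.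
by apply/lquot_piE; rewrite lquot_reprK.
Qed.

Let piD u v : lquot_pi (u + v) = lquot_pi u + lquot_pi v.
Proof.
have pi0 : lquot_pi 0 = 0 by rewrite -(subr0 0) lquot_pi_zmod subrr.
have piN w : lquot_pi (- w) = - lquot_pi w.
  by rewrite -[- w]add0r lquot_pi_zmod pi0 add0r.
by rewrite -{1}[v]opprK lquot_pi_zmod piN opprK.
Qed.

Fact lquot_scaleA a b x :
  lquot_scale a (lquot_scale b x) = lquot_scale (a * b) x.
Proof. by rewrite -(lquot_reprK x) -!lquot_piZ scalerA. Qed.

Fact lquot_scale1 : left_id 1 lquot_scale.
Proof. by move=> x; rewrite -(lquot_reprK x) -lquot_piZ scale1r. Qed.

Fact lquot_scaleDr : right_distributive lquot_scale +%R.
Proof.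
move=> a x y; rewrite -(lquot_reprK x) -(lquot_reprK y).
by rewrite -piD -!lquot_piZ scalerDr piD.
Qed.

Fact lquot_scaleDl x : {morph lquot_scale^~ x : a b / a + b}.
Proof.
by move=> a b; rewrite -(lquot_reprK x) -!lquot_piZ scalerDl piD.
Qed.

HB.instance Definition _ := GRing.Zmodule_isLmodule.Build S lquot
  lquot_scaleA lquot_scale1 lquot_scaleDr lquot_scaleDl.

Fact lquot_pi_linear : linear lquot_pi.
Proof. by move=> a u v; rewrite piD lquot_piZ. Qed.

HB.instance Definition _ := GRing.isLinear.Build S V lquot _ lquot_pi
  lquot_pi_linear.

End Quotient.

Section Submodule.
Variables (S : pzRingType) (V : lmodType S) (P : submodClosed V).

Definition lsub : Type := {x : V | x \in P}.
HB.instance Definition _ := SubChoice.on lsub.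
HB.instance Definition _ := [SubChoice_isSubLmodule of lsub by <:].

End Submodule.

Section Hom.
Variables (S : pzRingType) (M N : lmodType S).

Definition Hom : Type := {linear M -> N}.
Definition Hom_linear (f : Hom) : {linear M -> N} := f.

HB.instance Definition _ := gen_eqMixin Hom.
HB.instance Definition _ := gen_choiceMixin Hom.

Lemma Hom_ext (f g : Hom) : f =1 g -> f = g.
Proof.
case: f g => [f [[fn] [fs]]] [g [[gn] [gs]]] /= /funext fg.
rewrite /Hom in fn gn fs gs *; subst g.
by rewrite (Prop_irrelevance fn gn) (Prop_irrelevance fs gs).
Qed.

Definition Hom_zero : Hom := (\0 : M -> N)%R.
Definition Hom_opp (f : Hom) : Hom := (\- (f : {linear M -> N}))%R.
Definition Hom_add (f g : Hom) : Hom :=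
  ((f : {linear M -> N}) \+ (g : {linear M -> N}))%R.

Fact Hom_addA : associative Hom_add.
Proof. by move=> f g h; apply: Hom_ext => x /=; rewrite addrA. Qed.
Fact Hom_addC : commutative Hom_add.
Proof. by move=> f g; apply: Hom_ext => x /=; rewrite addrC. Qed.
Fact Hom_add0 : left_id Hom_zero Hom_add.
Proof. by move=> f; apply: Hom_ext => x /=; rewrite add0r. Qed.
Fact Hom_addN : left_inverse Hom_zero Hom_opp Hom_add.
Proof. by move=> f; apply: Hom_ext => x /=; rewrite addNr. Qed.

HB.instance Definition _ :=
  GRing.isZmodule.Build Hom Hom_addA Hom_addC Hom_add0 Hom_addN.

End Hom.

(* Tensor products over a noncommutative ring: the free abelian group on
    [A * B] modulo the relations making [(a, b) |-> a ** b] biadditive and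
    balanced. *)

Section Tensor.
Variables (S : pzRingType) (A : lmodType S^c) (B : lmodType S).
Local Notation free := {freeg (A * B)%type / int}.
Local Notation gen a b := (<< (a, b) >> : free).

Inductive tens_null : free -> Prop :=
| tens_null0 : tens_null 0
| tens_nullB x y : tens_null x -> tens_null y -> tens_null (x - y)
| tens_nullDl a a' b : tens_null (gen (a + a') b - (gen a b + gen a' b))
| tens_nullDr a b b' : tens_null (gen a (b + b') - (gen a b + gen a b'))
| tens_nullZ (s : S) a b : tens_null (gen ((s : S^c) *: a) b - gen a (s *: b)).

Definition tens_rel : {pred free} := fun x => `[< tens_null x >].

Fact tens_rel_zmod_closed : zmod_closed tens_rel.
Proof.
split=> [|x y /asboolP nx /asboolP ny]; apply/asboolP; first exact: tens_null0.
exact: tens_nullB.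
Qed.

HB.instance Definition _ := GRing.isZmodClosed.Build free tens_rel
  tens_rel_zmod_closed.

Definition tens : Type := Quotient.quot tens_rel.
HB.instance Definition _ := GRing.Zmodule.on tens.

Definition tens_pi (x : free) : tens := \pi_(Quotient.quot tens_rel) x.
Definition tens_repr (x : tens) : free := repr (x : Quotient.quot tens_rel).
Definition pure (a : A) (b : B) : tens := tens_pi (gen a b).

Lemma tens_reprK x : tens_pi (tens_repr x) = x.
Proof. exact: reprK. Qed.

Lemma tens_piE x y : tens_pi x = tens_pi y <-> tens_null (x - y).
Proof.
split=> [/eqP|h].
  by rewrite /tens_pi -Quotient.idealrBE => /asboolP.
by apply/eqP; rewrite /tens_pi -Quotient.idealrBE; apply/asboolP.
Qed.

Fact tens_pi_zmod : zmod_morphism tens_pi.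
Proof. exact: pi_is_zmod_morphism. Qed.

HB.instance Definition _ := GRing.isZmodMorphism.Build free tens tens_pi
  tens_pi_zmod.

Lemma pureDl a a' b : pure (a + a') b = pure a b + pure a' b.
Proof. by rewrite /pure -raddfD; apply/tens_piE/tens_nullDl. Qed.

Lemma pureDr a b b' : pure a (b + b') = pure a b + pure a b'.
Proof. by rewrite /pure -raddfD; apply/tens_piE/tens_nullDr. Qed.

Lemma pureZ (s : S) a b : pure ((s : S^c) *: a) b = pure a (s *: b).
Proof. exact/tens_piE/tens_nullZ. Qed.

Lemma tens_ind (P : tens -> Prop) : P 0 ->
  (forall x y, P x -> P y -> P (x - y)) ->
  (forall a b, P (pure a b)) -> forall x, P x.
Proof.
move=> P0 PB Pp x.
have PN y : P y -> P (- y) by move=> Py; rewrite -sub0r; apply: PB.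
have PD y z : P y -> P z -> P (y + z).
  by move=> Py Pz; rewrite -[z]opprK; apply: PB => //; apply: PN.
rewrite -(tens_reprK x) -(freeg_sumE (tens_repr x)) raddf_sum.
apply: (big_ind P) => // -[a b] _.
have Pn n : P (pure a b *+ n) by elim: n => // n IH; rewrite mulrS; apply: PD.
rewrite -[coeff _ _]intz -freegU_mulz raddfMz; case: (coeff _ _) => n.
  by rewrite -pmulrn; apply: Pn.
by rewrite NegzE mulrNz -pmulrn; apply/PN/Pn.
Qed.

Variable G : zmodType.

Definition balanced (f : A -> B -> G) : Prop :=
  [/\ forall a a' b, f (a + a') b = f a b + f a' b,
      forall a b b', f a (b + b') = f a b + f a b' &
      forall (s : S) a b, f ((s : S^c) *: a) b = f a (s *: b)].

Definition tens_lift (f : A -> B -> G) (x : tens) : G :=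
  fglift (fun p : A * B => f p.1 p.2 : zmodule G) (tens_repr x).

Section Lift.
Variables (f : A -> B -> G) (bf : balanced f).
Let lift : free -> zmodule G := fglift (fun p : A * B => f p.1 p.2 : zmodule G).

Let liftB x y : lift (x - y) = lift x - lift y.
Proof. exact: lift_is_additive. Qed.

Let lift0 : lift 0 = 0.
Proof. by rewrite -(subr0 0) liftB subrr. Qed.

Let liftD x y : lift (x + y) = lift x + lift y.
Proof. by rewrite -[y in LHS]opprK -[- y]sub0r !liftB lift0 sub0r opprK. Qed.

Let lift_gen a b : lift (gen a b) = f a b.
Proof. by rewrite /lift liftU scale1r. Qed.

Let lift_null x : tens_null x -> lift x = 0.
Proof.
case: bf => fDl fDr fZ; elim=> [|y z _ y0 _ z0|a a' b|a b b'|s a b].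
- exact: lift0.
- by rewrite liftB y0 z0 subr0.
- by rewrite liftB liftD !lift_gen fDl subrr.
- by rewrite liftB liftD !lift_gen fDr subrr.
- by rewrite liftB !lift_gen fZ subrr.
Qed.

Let lift_pi x : tens_lift f (tens_pi x) = lift x.
Proof.
apply/eqP; rewrite -subr_eq0 -[tens_lift _ _]/(lift _) -liftB; apply/eqP.
by apply/lift_null/tens_piE; rewrite tens_reprK.
Qed.

Lemma tens_lift_zmod : zmod_morphism (tens_lift f).
Proof.
move=> x y; rewrite -(tens_reprK x) -(tens_reprK y) -tens_pi_zmod.
by rewrite !lift_pi liftB.
Qed.

Lemma tens_lift_pure a b : tens_lift f (pure a b) = f a b.
Proof. by rewrite lift_pi lift_gen. Qed.

End Lift.
End Tensor.

Section TensorMap.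
Variables (S : pzRingType) (A A' : lmodType S^c) (B B' : lmodType S).
Variables (f : {linear A -> A'}) (g : {linear B -> B'}).

Definition tens_map : tens A B -> tens A' B' :=
  tens_lift (fun a b => pure (f a) (g b)).

Fact tens_map_balanced : balanced (fun a b => pure (f a) (g b)).
Proof.
split=> [a a' b|a b b'|s a b]; rewrite ?linearD ?pureDl ?pureDr//.
by rewrite !linearZ pureZ.
Qed.

Fact tens_map_zmod : zmod_morphism tens_map.
Proof. exact/tens_lift_zmod/tens_map_balanced. Qed.

HB.instance Definition _ := GRing.isZmodMorphism.Build (tens A B) (tens A' B')
  tens_map tens_map_zmod.

Lemma tens_map_pure a b : tens_map (pure a b) = pure (f a) (g b).
Proof. exact/tens_lift_pure/tens_map_balanced. Qed.

End TensorMap.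

Definition injective_module (S : pzRingType) (M : lmodType S) : Prop :=
  forall (X Y : lmodType S) (i : {linear X -> Y}) (f : {linear X -> M}),
    injective i -> exists g : {linear Y -> M}, forall x, g (i x) = f x.

Definition essential (S : pzRingType) (M N : lmodType S)
    (i : {linear M -> N}) : Prop :=
  forall P : submodClosed N, (exists2 n, n \in P & n != 0) ->
    exists2 m, i m \in P & i m != 0.

Record injective_envelope (S : pzRingType) (M : lmodType S) := InjectiveEnvelope {
  env_mod : lmodType S;
  env_map : {linear M -> env_mod};
  env_map_inj : injective env_map;
  env_map_essential : essential env_map;
  env_mod_injective : injective_module env_mod
}.

(* The right module [A (x)_L L], on which [L] acts through the right
    multiplications of the second factor *)

Section RegularTensor.
Variable L : pzRingType.

Definition rmul (s : L) (x : L^o) : L^o := (x : L) * s.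
Fact rmul_linear s : linear (rmul s).
Proof. by move=> a x y; rewrite /rmul mulrDl -mulrA. Qed.
HB.instance Definition _ s := GRing.isLinear.Build L L^o L^o _ (rmul s)
  (rmul_linear s).

Variable A : lmodType L^c.

Definition regtens : Type := tens A L^o.
HB.instance Definition _ := GRing.Zmodule.on regtens.

Definition regtens_scale (s : L^c) (x : regtens) : regtens :=
  tens_map idfun (rmul s) x.

Fact regtens_scale_zmod s : zmod_morphism (regtens_scale s).
Proof. exact: tens_map_zmod. Qed.
HB.instance Definition _ s := GRing.isZmodMorphism.Build regtens regtens
  (regtens_scale s) (regtens_scale_zmod s).

Lemma regtens_ind (P : regtens -> Prop) : P 0 ->
  (forall x y, P x -> P y -> P (x - y)) ->
  (forall a (b : L^o), P (pure a b)) -> forall x, P x.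
Proof. exact: tens_ind. Qed.

Lemma regtens_scale_pure s a (b : L^o) :
  regtens_scale s (pure a b) = pure a (rmul s b).
Proof. exact: tens_map_pure. Qed.

Fact regtens_scaleA (s t : L^c) x :
  regtens_scale s (regtens_scale t x) = regtens_scale (s * t) x.
Proof.
elim/regtens_ind: x => [|x y hx hy|a b]; first by rewrite !raddf0.
  by rewrite !raddfB /= hx hy.
by rewrite !regtens_scale_pure /rmul -mulrA.
Qed.

Fact regtens_scale1 : left_id 1 regtens_scale.
Proof.
elim/regtens_ind => [|x y hx hy|a b]; first by rewrite !raddf0.
  by rewrite raddfB /= hx hy.
by rewrite regtens_scale_pure /rmul mulr1.
Qed.

Fact regtens_scaleDr : right_distributive regtens_scale +%R.
Proof. by move=> s x y; rewrite raddfD. Qed.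

Fact regtens_scaleDl x : {morph regtens_scale^~ x : s t / s + t}.
Proof.
move=> s t; elim/regtens_ind: x => [|x y hx hy|a b].
- by rewrite !raddf0 addr0.
- by rewrite !raddfB /= hx hy opprD addrACA.
- by rewrite !regtens_scale_pure /rmul mulrDr; apply: pureDr.
Qed.

HB.instance Definition _ := GRing.Zmodule_isLmodule.Build L^c regtens
  regtens_scaleA regtens_scale1 regtens_scaleDr regtens_scaleDl.

End RegularTensor.

Section RegularTensorMap.
Variables (L : pzRingType) (A B : lmodType L^c) (f : {linear A -> B}).

Definition regtens_map : regtens A -> regtens B := tens_map f idfun.

Fact regtens_map_zmod : zmod_morphism regtens_map.
Proof. exact: tens_map_zmod. Qed.
HB.instance Definition _ := GRing.isZmodMorphism.Build (regtens A) (regtens B)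
  regtens_map regtens_map_zmod.

Lemma regtens_map_pure a (b : L^o) : regtens_map (pure a b) = pure (f a) b.
Proof. exact: tens_map_pure. Qed.

Fact regtens_map_scalable : scalable regtens_map.
Proof.
move=> s x; elim/regtens_ind: x => [|u v hu hv|a b].
- by rewrite !(raddf0, scaler0).
- by rewrite scalerBr !raddfB /= hu hv.
- rewrite regtens_map_pure -![s *: _]/(regtens_scale s _).
  by rewrite !regtens_scale_pure regtens_map_pure.
Qed.

HB.instance Definition _ := GRing.isScalable.Build L^c (regtens A) (regtens B) _
  regtens_map regtens_map_scalable.

End RegularTensorMap.

Section Torsion.
Variables (L : pzRingType) (E : injective_envelope L^o).

Section TensEnv.
Variable A : lmodType L^c.

Definition tens_env : regtens A -> tens A (env_mod E) :=
  tens_map idfun (env_map E).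

Fact tens_env_zmod : zmod_morphism tens_env.
Proof. exact: tens_map_zmod. Qed.
HB.instance Definition _ := GRing.isZmodMorphism.Build (regtens A)
  (tens A (env_mod E)) tens_env tens_env_zmod.

Lemma tens_env_pure a (b : L^o) : tens_env (pure a b) = pure a (env_map E b).
Proof. exact: tens_map_pure. Qed.

End TensEnv.

(* [tors E A] is the kernel of [1 (x) iota] as a submodule of [A (x)_L L]; closure
   under [L] uses the injectivity of the envelope, along which right
   multiplications extend. *)
Definition tors_rel (A : lmodType L^c) : {pred regtens A} :=
  fun x => tens_env x == 0.

Fact tors_rel_submod_closed A : submod_closed (@tors_rel A).
Proof.
split=> [|s x y]; rewrite ?unfold_in /tors_rel; first by rewrite raddf0.
move=> /eqP x0 /eqP y0.
have [e eE] := env_mod_injective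
  (env_map E \o @rmul L s : {linear L^o -> env_mod E}) (@env_map_inj _ _ E).
suff envZ u : tens_env (s *: u : regtens A) = tens_map idfun e (tens_env u).
  by rewrite raddfD /= envZ x0 y0 raddf0 addr0.
elim/regtens_ind: u => [|u v hu hv|a b].
- by rewrite scaler0 !raddf0.
- by rewrite scalerBr !raddfB /= hu hv.
- rewrite -[s *: _]/(regtens_scale s _) regtens_scale_pure !tens_env_pure.
  by rewrite tens_map_pure eE.
Qed.

HB.instance Definition _ A := GRing.isSubmodClosed.Build L^c (regtens A)
  (@tors_rel A) (@tors_rel_submod_closed A).

Definition tors (A : lmodType L^c) : lmodType L^c := lsub (@tors_rel A).

Variables (A B : lmodType L^c) (f : {linear A -> B}).

Fact tors_map_subproof (x : tors A) : regtens_map f (val x) \in @tors_rel B.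
Proof.
have := valP x; rewrite !unfold_in /tors_rel => /eqP x0; apply/eqP.
suff -> u : tens_env (regtens_map f u) = tens_map f idfun (tens_env u).
  by rewrite x0 raddf0.
elim/regtens_ind: u => [|u v hu hv|a b].
- by rewrite !raddf0.
- by rewrite !raddfB /= hu hv.
- by rewrite regtens_map_pure !tens_env_pure tens_map_pure.
Qed.

Definition tors_map (x : tors A) : tors B :=
  exist _ (regtens_map f (val x)) (tors_map_subproof x).

Fact tors_map_linear : linear tors_map.
Proof. by move=> s x y; apply: val_inj; rewrite /= !linearP. Qed.

HB.instance Definition _ := GRing.isLinear.Build L^c (tors A) (tors B) _
  tors_map tors_map_linear.

End Torsion.

Section Cotorsion.
Variable L : pzRingType.

(* [Hom_L(L, C)], with the left action [(s f)(x) = f (x s)] *)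
Section HomRegular.
Variable C : lmodType L.

Definition homreg : Type := Hom L^o C.
HB.instance Definition _ := GRing.Zmodule.on homreg.

Definition homreg_scale (s : L) (f : homreg) : homreg :=
  (f : {linear L^o -> C}) \o rmul s.

Fact homreg_scaleA s t f :
  homreg_scale s (homreg_scale t f) = homreg_scale (s * t) f.
Proof. by apply: Hom_ext => x; rewrite /= /rmul mulrA. Qed.
Fact homreg_scale1 : left_id 1 homreg_scale.
Proof. by move=> f; apply: Hom_ext => x; rewrite /= /rmul mulr1. Qed.
Fact homreg_scaleDr : right_distributive homreg_scale +%R.
Proof. by move=> s f g; apply: Hom_ext. Qed.
Fact homreg_scaleDl f : {morph homreg_scale^~ f : s t / s + t}.
Proof.
by move=> s t; apply: Hom_ext => x; rewrite /= /rmul mulrDr raddfD.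
Qed.

HB.instance Definition _ := GRing.Zmodule_isLmodule.Build L homreg
  homreg_scaleA homreg_scale1 homreg_scaleDr homreg_scaleDl.

End HomRegular.

Section Map.
Variables (C C' : lmodType L) (h : {linear C -> C'}).

Definition homreg_map (f : homreg C) : homreg C' :=
  h \o (f : {linear L^o -> C}).

Fact homreg_map_linear : linear homreg_map.
Proof. by move=> s f g; apply: Hom_ext => x; rewrite /= raddfD. Qed.

HB.instance Definition _ := GRing.isLinear.Build L (homreg C) (homreg C') _
  homreg_map homreg_map_linear.

End Map.

Variable E : injective_envelope L^o.

Definition hom_env (C : lmodType L) (g : Hom (env_mod E) C) : homreg C :=
  (g : {linear env_mod E -> C}) \o env_map E.

(* the image of [Hom_L(I, C) -> Hom_L(L, C)], precomposition with the envelope *)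
Definition cotors_rel (C : lmodType L) : {pred homreg C} :=
  fun f => `[< exists g : Hom (env_mod E) C, hom_env g = f >].

Fact cotors_rel_submod_closed C : submod_closed (@cotors_rel C).
Proof.
split=> [|s f f' /asboolP[g gf] /asboolP[g' gf']]; apply/asboolP.
  by exists 0; apply: Hom_ext.
have [e eE] := env_mod_injective
  (env_map E \o @rmul L s : {linear L^o -> env_mod E}) (@env_map_inj _ _ E).
exists (((g : {linear _ -> _}) \o e : Hom _ _) + g'); apply: Hom_ext => x.
by rewrite -gf -gf' /= eE.
Qed.

HB.instance Definition _ C := GRing.isSubmodClosed.Build L (homreg C)
  (@cotors_rel C) (@cotors_rel_submod_closed C).

Definition cotors (C : lmodType L) : lmodType L := lquot (@cotors_rel C).

Variables (C C' : lmodType L) (h : {linear C -> C'}).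

Definition cotors_map (x : cotors C) : cotors C' :=
  lquot_pi (@cotors_rel C') (homreg_map h (lquot_repr x)).

Lemma cotors_map_pi (f : homreg C) :
  cotors_map (lquot_pi (@cotors_rel C) f) =
  lquot_pi (@cotors_rel C') (homreg_map h f).
Proof.
apply/lquot_piE; rewrite -linearB.
have /lquot_piE/asboolP[g gE] := lquot_reprK (lquot_pi (@cotors_rel C) f).
by apply/asboolP; exists (h \o (g : {linear _ -> _})); rewrite -gE; apply: Hom_ext.
Qed.

Fact cotors_map_linear : linear cotors_map.
Proof.
move=> s x y; rewrite -(lquot_reprK x) -(lquot_reprK y) -linearP.
by rewrite !cotors_map_pi !linearP.
Qed.

HB.instance Definition _ := GRing.isLinear.Build L (cotors C) (cotors C') _
  cotors_map cotors_map_linear.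

End Cotorsion.

Section Dual.
Variables (R : comPzRingType) (L : pzAlgType R).

Section Restriction.
Variable A : lmodType L^c.

Definition restr : Type := A.
HB.instance Definition _ := GRing.Zmodule.on restr.

Definition restr_scale (r : R) (x : restr) : restr :=
  (alg_map r : L^c) *: (x : A).

Fact restr_scaleA r r' x :
  restr_scale r (restr_scale r' x) = restr_scale (r * r') x.
Proof. by rewrite /restr_scale scalerA mulrC rmorphM. Qed.
Fact restr_scale1 : left_id 1 restr_scale.
Proof. by move=> x; rewrite /restr_scale rmorph1 scale1r. Qed.
Fact restr_scaleDr : right_distributive restr_scale +%R.
Proof. by move=> r x y; rewrite /restr_scale scalerDr. Qed.
Fact restr_scaleDl x : {morph restr_scale^~ x : r r' / r + r'}.
Proof. by move=> r r'; rewrite /restr_scale rmorphD scalerDl. Qed.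

HB.instance Definition _ := GRing.Zmodule_isLmodule.Build R restr
  restr_scaleA restr_scale1 restr_scaleDr restr_scaleDl.

(* the action of [s : L] is [R]-linear since [R] acts through central elements *)
Definition restr_act (s : L) (x : restr) : restr := (s : L^c) *: (x : A).

Fact restr_act_linear s : linear (restr_act s).
Proof.
move=> r x y; rewrite /restr_act scalerDr; congr (_ + _).
have cs : (s : L^c) * alg_map r = (alg_map r : L^c) * s.
  exact: alg_map_central.
by rewrite -![r *: _]/(restr_scale r _) /restr_scale !scalerA cs.
Qed.

HB.instance Definition _ s := GRing.isLinear.Build R restr restr _ (restr_act s)
  (restr_act_linear s).

End Restriction.

Variable J : lmodType R.

(* [Hom_R(A, J)], with the left action [(s f)(x) = f (x s)] *)
Section DualModule.
Variable A : lmodType L^c.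

Definition dual : Type := Hom (restr A) J.
HB.instance Definition _ := GRing.Zmodule.on dual.

Definition dual_scale (s : L) (f : dual) : dual :=
  (f : {linear restr A -> J}) \o restr_act s.

Fact dual_scaleA s t f : dual_scale s (dual_scale t f) = dual_scale (s * t) f.
Proof. by apply: Hom_ext => x; rewrite /= /restr_act scalerA. Qed.
Fact dual_scale1 : left_id 1 dual_scale.
Proof. by move=> f; apply: Hom_ext => x; rewrite /= /restr_act scale1r. Qed.
Fact dual_scaleDr : right_distributive dual_scale +%R.
Proof. by move=> s f g; apply: Hom_ext. Qed.
Fact dual_scaleDl f : {morph dual_scale^~ f : s t / s + t}.
Proof.
by move=> s t; apply: Hom_ext => x; rewrite /= /restr_act scalerDl raddfD.
Qed.

HB.instance Definition _ := GRing.Zmodule_isLmodule.Build L dual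
  dual_scaleA dual_scale1 dual_scaleDr dual_scaleDl.

End DualModule.

Section DualMap.
Variables (A B : lmodType L^c) (f : {linear A -> B}).

Definition restr_map (x : restr A) : restr B := f x.
Fact restr_map_linear : linear restr_map.
Proof. by move=> r x y; rewrite /restr_map raddfD /= [in LHS]linearZ. Qed.
HB.instance Definition _ := GRing.isLinear.Build R (restr A) (restr B) _
  restr_map restr_map_linear.

Definition dual_map (g : dual B) : dual A :=
  (g : {linear restr B -> J}) \o restr_map.

Fact dual_map_linear : linear dual_map.
Proof.
move=> s g h; apply: Hom_ext => x /=; congr (g _ + _).
by rewrite /restr_act /restr_map linearZ.
Qed.

HB.instance Definition _ := GRing.isLinear.Build L (dual B) (dual A) _
  dual_map dual_map_linear.

End DualMap.
End Dual.

Arguments dual {R L} J A.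
Arguments dual_map {R L} J {A B} f g.
Arguments tors {L} E A.
Arguments tors_map {L} E {A B} f x.
Arguments cotors {L} E C.
Arguments cotors_map {L} E {C C'} h x.

(* Main.v *)
(* Hom-tensor adjunction identifies Hom_R(A (x)_L M, J) with Hom_L(M, D_J A),
   naturally in A and M.  For M = L, restriction to the torsion submodule
   gives a map [tors_res] from Hom_L(L, D_J A) to D_J (s A), which is surjective as
   J is injective.  A map F lies in its kernel iff its adjoint kills
   the kernel of 1 (x) iota, iff (J being injective) this adjoint factors through
   1 (x) iota, iff F factors through iota; hence the kernel is the submodule
   divided out in q (D_J A). *)
Require Import Defs.
From HB Require Import structures.
From mathcomp Require Import all_boot all_order all_algebra.
From mathcomp Require Import boolp.

Set Implicit Arguments.
Unset Strict Implicit.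
Unset Printing Implicit Defensive.

Import GRing.Theory.
Local Open Scope ring_scope.

(** * Factoring maps into an injective module *)

(** Both [h] and [G] descend to [X] modulo the kernel of [h]. The map induced by [h] is injective,
    so injectivity of [J] extends the one induced by [G] along it. *)
Lemma injective_module_factor (S : pzRingType) (J X Y : lmodType S)
    (h : {linear X -> Y}) (G : {linear X -> J}) :
  injective_module J -> (forall x, h x = 0 -> G x = 0) ->
  exists g : {linear Y -> J}, forall x, g (h x) = G x.
Proof.
move=> hJ hG.
pose K : {pred X} := fun x => h x == 0.
have Kclosed : submod_closed K.
  split=> [|s x y]; rewrite ?unfold_in /K ?raddf0//.
  by move=> /eqP x0 /eqP y0; rewrite linearP x0 y0 scaler0 addr0.
pose Kpack := GRing.isSubmodClosed.Build S X K Kclosed.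
pose P : submodClosed X := HB.pack K Kpack.
(* Stated for a general [k] so as to serve both [h] and [G]: the chosen representative differs from
   [x] by an element of the kernel of [h]. *)
have reprE (T : lmodType S) (k : {linear X -> T}) :
    (forall x, h x = 0 -> k x = 0) ->
    forall x, k (lquot_repr (lquot_pi P x)) = k x.
  move=> hk x.
  have /lquot_piE/eqP hx := lquot_reprK (lquot_pi P x).
  by apply/eqP; rewrite -subr_eq0 -raddfB; apply/eqP/hk.
have repr_linear (T : lmodType S) (k : {linear X -> T}) :
    (forall x, h x = 0 -> k x = 0) -> linear (fun x : lquot P => k (lquot_repr x)).
  move=> hk s x y; rewrite -(lquot_reprK x) -(lquot_reprK y) -linearP.
  by rewrite !reprE// linearP.
pose hbar : {linear lquot P -> Y} := HB.pack (fun x : lquot P => h (lquot_repr x))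
  (GRing.isLinear.Build S (lquot P) Y *:%R _ (@repr_linear Y h (fun _ => id))).
pose Gbar : {linear lquot P -> J} := HB.pack (fun x : lquot P => G (lquot_repr x))
  (GRing.isLinear.Build S (lquot P) J *:%R _ (@repr_linear J G hG)).
have hbar_inj : injective hbar.
  move=> x y /= hxy; rewrite -(lquot_reprK x) -(lquot_reprK y).
  apply/lquot_piE; rewrite unfold_in /= /K raddfB subr_eq0; exact/eqP.
have [g gE] := hJ _ _ hbar Gbar hbar_inj.
exists g => x; have := gE (lquot_pi P x).
by rewrite /= !reprE.
Qed.

(** * The [R]-module structure on the tensor product *)

Section CentralTensor.
Variables (R : comPzRingType) (L : pzAlgType R).

Section Scaling.
Variable M : lmodType L.

(** Centrality of [alg_map r] makes this [L]-linear, so it induces an endomorphism of the tensor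
    product. *)
Definition central_act (r : R) (m : M) : M := alg_map r *: m.

Fact central_act_linear r : linear (central_act r).
Proof.
by move=> s x y; rewrite /central_act scalerDr !scalerA alg_map_central.
Qed.
HB.instance Definition _ r := GRing.isLinear.Build L M M _ (central_act r)
  (central_act_linear r).

Variable A : lmodType L^c.

(* [A (x)_L M] as an [R]-module *)
Definition rtens : Type := tens A M.
HB.instance Definition _ := GRing.Zmodule.on rtens.

Definition rtens_scale (r : R) (x : rtens) : rtens :=
  tens_map idfun (central_act r) x.

Fact rtens_scale_zmod r : zmod_morphism (rtens_scale r).
Proof. exact: tens_map_zmod. Qed.
HB.instance Definition _ r := GRing.isZmodMorphism.Build rtens rtens
  (rtens_scale r) (rtens_scale_zmod r).

Lemma rtens_ind (P : rtens -> Prop) : P 0 ->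
  (forall x y, P x -> P y -> P (x - y)) ->
  (forall a (m : M), P (pure a m)) -> forall x, P x.
Proof. exact: tens_ind. Qed.

Lemma rtens_scale_pure r (a : A) (m : M) :
  rtens_scale r (pure a m) = pure a (alg_map r *: m).
Proof. exact: tens_map_pure. Qed.

Fact rtens_scaleA r t x : rtens_scale r (rtens_scale t x) = rtens_scale (r * t) x.
Proof.
elim/rtens_ind: x => [|x y hx hy|a m]; first by rewrite !raddf0.
  by rewrite !raddfB /= hx hy.
by rewrite !rtens_scale_pure scalerA rmorphM.
Qed.

Fact rtens_scale1 : left_id 1 rtens_scale.
Proof.
elim/rtens_ind => [|x y hx hy|a m]; first by rewrite !raddf0.
  by rewrite raddfB /= hx hy.
by rewrite rtens_scale_pure rmorph1 scale1r.
Qed.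

Fact rtens_scaleDr : right_distributive rtens_scale +%R.
Proof. by move=> r x y; rewrite raddfD. Qed.

Fact rtens_scaleDl x : {morph rtens_scale^~ x : r t / r + t}.
Proof.
move=> r t; elim/rtens_ind: x => [|x y hx hy|a m].
- by rewrite !raddf0 addr0.
- by rewrite !raddfB /= hx hy opprD addrACA.
- by rewrite !rtens_scale_pure rmorphD scalerDl; apply: pureDr.
Qed.

HB.instance Definition _ := GRing.Zmodule_isLmodule.Build R rtens
  rtens_scaleA rtens_scale1 rtens_scaleDr rtens_scaleDl.

End Scaling.

(** * Hom-tensor adjunction *)

Section Adjunction.
Variables (J : lmodType R) (A : lmodType L^c) (M : lmodType L).

Section Curry.
Variable g : {linear rtens M A -> J}.

Definition curry_at (m : M) (a : restr A) : J := g (pure (a : A) m).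

Fact curry_at_linear m : linear (curry_at m).
Proof.
move=> r a b; rewrite /curry_at.
rewrite [pure _ _](pureDl (restr_scale r a) b m) raddfD /=; congr (_ + _).
(* Balancedness moves the scalar from [A] to the second factor, where [R] acts on [rtens]. *)
rewrite /restr_scale pureZ -linearZ; congr (g _).
by rewrite -[RHS]/(rtens_scale r _) rtens_scale_pure.
Qed.
HB.instance Definition _ m := GRing.isLinear.Build R (restr A) J _ (curry_at m)
  (curry_at_linear m).

Definition curry (m : M) : dual J A := curry_at m.

Fact curry_linear : linear curry.
Proof.
move=> s m n; apply: Hom_ext => a /=; rewrite /curry_at.
by rewrite pureDr -pureZ raddfD.
Qed.
HB.instance Definition _ := GRing.isLinear.Build L M (dual J A) _ curry
  curry_linear.

End Curry.

Section Uncurry.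
Variable F : {linear M -> dual J A}.

Definition eval (a : A) (m : M) : J := Hom_linear (F m) (a : restr A).

Fact eval_balanced : balanced eval.
Proof.
split=> [a b m|a m n|s a m]; rewrite /eval.
- exact: (raddfD (Hom_linear (F m))).
- by rewrite linearD.
- by rewrite linearZ.
Qed.

Definition uncurry : rtens M A -> J := tens_lift eval.

Fact uncurry_zmod : zmod_morphism uncurry.
Proof. exact/tens_lift_zmod/eval_balanced. Qed.
HB.instance Definition _ := GRing.isZmodMorphism.Build (rtens M A) J uncurry
  uncurry_zmod.

Lemma uncurry_pure a m : uncurry (pure a m) = Hom_linear (F m) (a : restr A).
Proof. exact/tens_lift_pure/eval_balanced. Qed.

Fact uncurry_scalable : scalable uncurry.
Proof.
move=> r x; elim/rtens_ind: x => [|x y hx hy|a m].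
- by rewrite scaler0 !raddf0.
- by rewrite scalerBr !raddfB /= hx hy.
- rewrite -[r *: (_ : rtens M A)]/(rtens_scale r _) rtens_scale_pure -pureZ.
  by rewrite !uncurry_pure -[RHS]linearZ.
Qed.
HB.instance Definition _ := GRing.isScalable.Build R (rtens M A) J _ uncurry
  uncurry_scalable.

End Uncurry.

Lemma uncurryP (F : {linear M -> dual J A}) (G : {linear rtens M A -> J}) :
  (forall a m, Hom_linear (F m) a = G (pure (a : A) m)) -> uncurry F =1 G.
Proof.
move=> FG; elim/rtens_ind => [|x y hx hy|a m]; first by rewrite !raddf0.
  by rewrite !raddfB /= hx hy.
by rewrite uncurry_pure FG.
Qed.

End Adjunction.
End CentralTensor.

(** * Restriction of adjoints to the torsion submodule *)

Section TorsionRestriction.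
Variables (R : comPzRingType) (L : pzAlgType R) (J : lmodType R).
Variables (E : injective_envelope L^o).

Section Inclusion.
Variable A : lmodType L^c.

Definition tors_incl (x : restr (tors E A)) : rtens L^o A := val (x : tors E A).

(** On the second factor, [r] acts by right multiplication by [alg_map r] in the source and by left
    multiplication in the target; centrality makes them agree. *)
Fact tors_incl_linear : linear tors_incl.
Proof.
move=> r x y; rewrite /tors_incl raddfD; congr (_ + _).
rewrite -[r *: x]/((alg_map r : L^c) *: (x : tors E A)) [LHS]linearZ /=.
elim/regtens_ind: (val _) => [|u v hu hv|a b].
- by rewrite !scaler0.
- by rewrite !scalerBr hu hv.
- rewrite -[LHS]/(regtens_scale _ _) regtens_scale_pure.
  rewrite -[RHS]/(rtens_scale r _) rtens_scale_pure; congr pure.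
  by rewrite /rmul -alg_map_central.
Qed.
HB.instance Definition _ := GRing.isLinear.Build R (restr (tors E A))
  (rtens L^o A) _ tors_incl tors_incl_linear.

Definition renv : rtens L^o A -> rtens (env_mod E) A := @tens_env L E A.

Fact renv_zmod : zmod_morphism renv.
Proof. exact: tens_env_zmod. Qed.
HB.instance Definition _ := GRing.isZmodMorphism.Build (rtens L^o A)
  (rtens (env_mod E) A) renv renv_zmod.

Fact renv_scalable : scalable renv.
Proof.
move=> r x; elim/rtens_ind: x => [|x y hx hy|a m].
- by rewrite scaler0 !raddf0.
- by rewrite scalerBr !raddfB /= hx hy.
- rewrite -![r *: _]/(rtens_scale r _) rtens_scale_pure.
  by rewrite /renv !tens_env_pure rtens_scale_pure linearZ.
Qed.
HB.instance Definition _ := GRing.isScalable.Build R (rtens L^o A)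
  (rtens (env_mod E) A) _ renv renv_scalable.

Definition tors_res (F : homreg (dual J A)) : dual J (tors E A) :=
  uncurry (Hom_linear F) \o tors_incl.

(** On a pure tensor of [a] and [b], the adjoint of [s *: F] and the adjoint of [F] after the action
    of [s] both give [F (b * s)] evaluated at [a]. *)
Fact tors_res_linear : linear tors_res.
Proof.
move=> s F G; apply: Hom_ext => x /=.
rewrite /restr_act /tors_incl linearZ /=.
elim/regtens_ind: (val _) => [|u v hu hv|a b].
- by rewrite scaler0 !raddf0 addr0.
- by rewrite scalerBr !raddfB /= hu hv opprD addrACA.
- rewrite -[(s : L^c) *: (pure a b : regtens A)]/(regtens_scale s _) regtens_scale_pure.
  by rewrite !uncurry_pure.
Qed.
HB.instance Definition _ := GRing.isLinear.Build L (homreg (dual J A))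
  (dual J (tors E A)) _ tors_res tors_res_linear.

Lemma tors_res_surj : injective_module J -> forall u, exists F, tors_res F = u.
Proof.
move=> hJ u; have incl_inj : injective tors_incl by move=> x y /val_inj.
have [g gE] := hJ _ _ tors_incl (Hom_linear u) incl_inj.
(* Here [g] extends [u] to the whole tensor product. *)
exists (curry g : {linear L^o -> dual J A}); apply: Hom_ext => x /=.
by rewrite (uncurryP (G := g))// gE.
Qed.

Lemma tors_res_eq0 : injective_module J ->
  forall F, tors_res F = 0 <-> F \in @cotors_rel L E (dual J A).
Proof.
move=> hJ F; split=> [F0|/asboolP[g gF]]; last first.
  apply: Hom_ext => x /=.
  (* If [F] is [g] after the envelope map, its adjoint is that of [g] after [renv], which kills the
     torsion. *)
  pose G : {linear rtens L^o A -> J} :=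
    uncurry (Hom_linear g) \o renv.
  rewrite (uncurryP (G := G)) /=.
    have /eqP x0 := valP (x : tors E A).
    by rewrite /renv /tors_incl x0 raddf0.
  by move=> a m; rewrite /renv tens_env_pure uncurry_pure -gF.
have ker0 x : renv x = 0 -> uncurry (Hom_linear F) x = 0.
  move=> /eqP x0; pose t : restr (tors E A) := exist _ x x0.
  by have := congr1 (fun u : dual J (tors E A) => Hom_linear u t) F0.
(* Since [renv] need not be injective, the kernel condition is what lets the adjoint of [F] factor
   through it. *)
have [g gE] := injective_module_factor hJ ker0.
apply/asboolP; exists (curry g : {linear env_mod E -> dual J A}).
apply: Hom_ext => m; apply: Hom_ext => a /=.
rewrite /curry_at -tens_env_pure.
exact: etrans (gE _) (uncurry_pure (Hom_linear F) _ _).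
Qed.

End Inclusion.

(** The two adjoints already agree on all of [regtens A]: a pure tensor of [a] and [b] goes to [F b]
    evaluated at [f a]. *)
Lemma tors_res_natural (A B : lmodType L^c) (f : {linear A -> B})
    (F : homreg (dual J B)) :
  tors_res (homreg_map (dual_map J f) F) = dual_map J (tors_map E f) (tors_res F).
Proof.
apply: Hom_ext => x /=; rewrite /tors_incl /=.
elim/regtens_ind: (val _) => [|u v hu hv|a b].
- by rewrite !raddf0.
- by rewrite !raddfB /= hu hv.
- by rewrite regtens_map_pure !uncurry_pure.
Qed.

(** * The isomorphism onto the cotorsion module *)

Section Inverse.
Hypothesis hJ : injective_module J.

(** An arbitrary choice of preimage, not claimed to be linear in [u]; only its class in the
    cotorsion module matters. *)
Definition tors_lift A (u : dual J (tors E A)) : homreg (dual J A) :=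
  sval (cid (tors_res_surj hJ u)).

Lemma tors_liftK A : cancel (@tors_lift A) (@tors_res A).
Proof. by move=> u; rewrite /tors_lift; case: cid. Qed.

Definition dual_tors_cotors A (u : dual J (tors E A)) : cotors E (dual J A) :=
  lquot_pi (@cotors_rel L E (dual J A)) (tors_lift u).

(** Independence of the choice: two preimages differ by an element of the kernel of [tors_res],
    which is the submodule divided out. Linearity and naturality reduce to those of [tors_res]. *)
Lemma dual_tors_cotorsE A (F : homreg (dual J A)) :
  dual_tors_cotors (tors_res F) = lquot_pi (@cotors_rel L E (dual J A)) F.
Proof.
by apply/lquot_piE/(tors_res_eq0 hJ); rewrite raddfB /= tors_liftK subrr.
Qed.

Fact dual_tors_cotors_linear A : linear (@dual_tors_cotors A).
Proof.
move=> s u v; rewrite -(tors_liftK u) -(tors_liftK v) -linearP.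
by rewrite !dual_tors_cotorsE linearP.
Qed.
HB.instance Definition _ A := GRing.isLinear.Build L (dual J (tors E A))
  (cotors E (dual J A)) _ (@dual_tors_cotors A) (@dual_tors_cotors_linear A).

Lemma dual_tors_cotors_bij A : bijective (@dual_tors_cotors A).
Proof.
(* The inverse restricts any representative, as [tors_res] vanishes on [cotors_rel]. *)
exists (fun x => tors_res (lquot_repr x)) => [u|x].
  apply/eqP; rewrite -subr_eq0 -[X in _ - X]tors_liftK -raddfB; apply/eqP.
  exact/(tors_res_eq0 hJ)/lquot_piE/lquot_reprK.
by rewrite dual_tors_cotorsE lquot_reprK.
Qed.

End Inverse.
End TorsionRestriction.

Theorem proposition4p9 (R : comPzRingType) (L : pzAlgType R) (J : lmodType R)
    (hJ : injective_module J) (E : injective_envelope L^o) :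
  exists phi : forall A : lmodType L^c,
      {linear dual J (tors E A) -> cotors E (dual J A)},
    (forall A : lmodType L^c, bijective (phi A)) /\
    (forall (A B : lmodType L^c) (f : {linear A -> B}) (x : dual J (tors E B)),
       phi A (dual_map J (tors_map E f) x) =
       cotors_map E (dual_map J f) (phi B x)).
Proof.
exists (fun A => @dual_tors_cotors R L J E hJ A); split=> [A|A B f x].
  exact: dual_tors_cotors_bij.
rewrite /= -{1}(tors_liftK hJ x) -tors_res_natural dual_tors_cotorsE.
by rewrite cotors_map_pi.
Qed.
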